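(* Let $a,b\in\mathbb{R}$ satisfy $\tfrac12\le a<\tfrac58$ and $0<b<\tfrac12$, and let $c_{W,1},c_{W,2},c_w>0$. Let $\mu=(\mu_k)_{k\in\mathbb{N}^*}$ be an increasing sequence of distinct real numbers with $\mu_1\ge 1$ such that $$c_{W,1}\Gamma^{a}-c_{W,2}\Gamma^{b}\le \mathcal N_\mu(\Gamma)\le c_{W,1}\Gamma^{a}+c_{W,2}\Gamma^{b}\qquad\text{for all }\Gamma\ge\mu_1,$$ $$\mu_{k+1}-\mu_k\ge \exp\left(-c_w\mu_k^{1/2}\right)\qquad\text{for all }k\in\mathbb{N}^*.$$ Then the condensation index of $\mu$ is zero: $c(\mu)=0$.
   Context: $\mathbb{N}^*=\{1,2,3,\dots\}$. For a non-decreasing sequence $\lambda=(\lambda_k)_{k\in\mathbb{N}^*}$ of positive reals, $\mathcal N_\lambda(\Gamma)=\#\{k\in\mathbb{N}^*:\lambda_k\le\Gamma\}$. Condensation index: let $\lambda=(\lambda_k)_{k\in\mathbb{N}^*}\subset\mathbb{C}\setminus\{0\}$ be a sequence of pairwise distinct numbers with $(\lambda_k^{-1})_k\in\ell^1$ and such that, for some $\alpha>0$, $\operatorname{Re}(\lambda_k)\ge\alpha|\lambda_k|$ for all $k\ge1$. Its condensation index is $$c(\lambda)=\limsup_{k\to+\infty}\frac{\log\left(\frac{1}{|E'(\lambda_k)|}\right)}{\operatorname{Re}(\lambda_k)},\qquad E(z)=\prod_{k\in\mathbb{N}^*}\left(1-\frac{z^2}{\lambda_k^2}\right),\quad z\in\mathbb{C}.$$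 *)

(* Defs.v *)
From HB Require Import structures.
From mathcomp Require Import all_boot all_order all_algebra.
From mathcomp Require Import all_classical all_reals all_analysis.
From mathcomp Require Import complex.

Set Implicit Arguments.
Unset Strict Implicit.
Unset Printing Implicit Defensive.

Import Order.TTheory GRing.Theory Num.Theory.
Import numFieldNormedType.Exports.

Local Open Scope classical_set_scope.
Local Open Scope ring_scope.
Local Open Scope complex_scope.

(* Sequences indexed by {1, 2, 3, ...} are shifted to nat: the term of index k
   here is the usual (k+1)-st term. *)

(* Extended-real valued: +oo when infinitely many terms are <= G. *)
Definition counting_function (R : realType) (lambda : nat -> R) (G : R) :
    \bar R :=
  counting [set k : nat | lambda k <= G].

(* The modulus as an element of R (the norm `|z| of R[i] lives in R[i]). *)
Definition cmod (R : realType) (z : R[i]) : R := Normc.normc z.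

(* The sequences for which the condensation index is defined. *)
Definition condensation_admissible (R : realType) (lambda : nat -> R[i]) :
    Prop :=
  [/\ forall k, lambda k != 0,
      injective lambda,
      cvgn (series (fun k => cmod (lambda k)^-1)) &
      exists2 alpha : R, 0 < alpha &
        forall k, alpha * cmod (lambda k) <= complex.Re (lambda k)].

(* R[i]^o carries the topology of R[i] as a normed module over itself, so that
   limits and derivatives are the complex ones. *)
Definition condensation_product (R : realType) (lambda : nat -> R[i])
    (z : R[i]^o) : R[i]^o :=
  limn (fun n => \prod_(0 <= k < n) (1 - z ^+ 2 / lambda k ^+ 2) : R[i]^o).

Definition condensation_index (R : realType) (lambda : nat -> R[i]) : \bar R :=
  limn_esup (fun k =>
    (ln (1 / cmod (derive1 (condensation_product lambda) (lambda k)))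
       / complex.Re (lambda k))%:E).

(* Main.v *)
(** Put [x = mu k]. Cancelling the factor of [E] that vanishes at [x] gives
    [E'(x) = - (2 / x) * \prod_(j != k) (1 - x^2 / mu_j^2)], so it suffices that
    the logarithm of this product is [o(x)]. The factors are of three kinds.
    Those with [mu_j > 2 x] contribute at most [x / mu_j] each, hence [o(x)]
    altogether, since [\sum_j 1 / mu_j] converges ([a < 1]). Among the [O(x^a)]
    others, those with [|mu_j - x| >= 1] contribute [O(log x)] each. Finally the
    counting estimates leave only [O(x^b)] points at distance less than [1] of
    [x], and by the gap condition each of them costs [O(sqrt x)], for a total of
    [O(x^(b + 1/2)) = o(x)]. *)

Require Import Defs.
From HB Require Import structures.
From mathcomp Require Import all_boot all_order all_algebra.
From mathcomp Require Import all_classical all_reals all_analysis.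
From mathcomp Require Import complex.
From mathcomp Require Import ring lra zify.

Import Order.TTheory GRing.Theory Num.Theory.
Import numFieldNormedType.Exports.

Local Open Scope classical_set_scope.
Local Open Scope ring_scope.
Local Open Scope complex_scope.

Set Implicit Arguments.
Unset Strict Implicit.

(** * Real-valued modulus on [R[i]], limits and finite products *)

Lemma cmod_norm (R : realType) (z : R[i]) : `|z| = (cmod z)%:C.
Proof. by case: z. Qed.

Lemma cmod_ge0 (R : realType) (z : R[i]) : 0 <= cmod z.
Proof. by case: z => x y; rewrite sqrtr_ge0. Qed.

Lemma cmodM (R : realType) (z w : R[i]) : cmod (z * w) = cmod z * cmod w.
Proof. exact: Normc.normcM. Qed.

Lemma cmod_realC (R : realType) (x : R) : cmod x%:C = `|x|.
Proof. by rewrite /cmod /= expr0n addr0 sqrtr_sqr. Qed.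

Lemma cmod0 (R : realType) : cmod (0 : R[i]) = 0.
Proof. by rewrite -[0 in LHS]/(0%:C) cmod_realC normr0. Qed.

Lemma cmod1 (R : realType) : cmod (1 : R[i]) = 1.
Proof. by rewrite -[1 in LHS]/(1%:C) cmod_realC normr1. Qed.

Lemma ler_cmodD (R : realType) (z w : R[i]) : cmod (z + w) <= cmod z + cmod w.
Proof. by rewrite -lecR rmorphD /= -!cmod_norm ler_normD. Qed.

Lemma cmodN (R : realType) (z : R[i]) : cmod (- z) = cmod z.
Proof. by case: z => x y; rewrite /cmod /= !sqrrN. Qed.

Lemma cmodB (R : realType) (z w : R[i]) : cmod (z - w) = cmod (w - z).
Proof. by rewrite -cmodN opprB. Qed.

Lemma cmodX (R : realType) (z : R[i]) n : cmod (z ^+ n) = cmod z ^+ n.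
Proof.
elim: n => [|n IH]; last by rewrite !exprS cmodM IH.
by rewrite !expr0 cmod1.
Qed.

Lemma cmodV (R : realType) (z : R[i]) : cmod z^-1 = (cmod z)^-1.
Proof. exact: Normc.normcV. Qed.

Lemma ler_Re_cmod (R : realType) (z : R[i]) : `|complex.Re z| <= cmod z.
Proof. by case: z => x y; rewrite /cmod /= -sqrtr_sqr ler_wsqrtr// lerDl sqr_ge0. Qed.

Lemma ler_Im_cmod (R : realType) (z : R[i]) : `|complex.Im z| <= cmod z.
Proof. by case: z => x y; rewrite /cmod /= -sqrtr_sqr ler_wsqrtr// lerDr sqr_ge0. Qed.

Lemma ler_cmod_ReIm (R : realType) (z : R[i]) :
  cmod z <= `|complex.Re z| + `|complex.Im z|.
Proof.
case: z => x y /=; rewrite -[X in _ <= X]ger0_norm ?addr_ge0// -sqrtr_sqr ler_wsqrtr//.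
by rewrite sqrrD !real_normK ?num_real// -addrA lerD2l lerDr mulrn_wge0 ?mulr_ge0.
Qed.

(** The norm of [R[i]] takes values in [R[i]], so its limits quantify over complex radii; this
    brings them back to real ones. *)
Lemma cvg_cmodP (R : realType) (T : Type) (F : set_system T) {FF : Filter F}
    (u : T -> R[i]) (l : R[i]) :
  (forall e : R, 0 < e -> \forall x \near F, cmod (l - u x) < e) <->
  ((u : T -> R[i]^o) @ F --> (l : R[i]^o)).
Proof.
split=> [H|/cvgrPdist_lt H e e0].
  (* A positive element of [R[i]] has zero imaginary part. *)
  apply/cvgrPdist_lt => -[er ei]; rewrite ltcE /= => /andP[/eqP-> er0].
  apply: filterS (H _ er0) => x /=.
  by rewrite -ltcR -cmod_norm.
have := H e%:C; rewrite ltcR => /(_ e0); apply: filterS => x /=.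
by rewrite cmod_norm ltcR.
Qed.

(** Real and imaginary parts are additive and dominated by [cmod], so each has absolutely summable
    increments and converges by completeness of [R]. *)
Lemma is_cvg_complex_dom (R : realType) (u : nat -> R[i]) (v : nat -> R) :
  (forall n, cmod (u n.+1 - u n) <= v n) -> cvgn (series v) ->
  cvgn (u : nat -> R[i]^o).
Proof.
move=> uv cv.
have key (f : R[i] -> R) : {morph f : x y / x - y} ->
    (forall z, `|f z| <= cmod z) -> cvgn (f \o u).
  move=> fB fle.
  have : cvgn (series (fun n => f (u n.+1) - f (u n))).
    apply: (@normed_cvg _ R^o); apply: series_le_cvg cv => n //=.
      by rewrite (le_trans (cmod_ge0 _) (uv n)).
    by rewrite -fB (le_trans (fle _)).
  move=> /cvg_ex[l /cvgrPdist_lt hl]; apply/cvg_ex; exists (l + f (u 0%N)).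
  apply/cvgrPdist_lt => e e0; apply: filterS (hl e e0) => n /=.
  rewrite /series /= telescope_sumr// opprB.
  by have -> : l + (f (u 0%N) - f (u n)) = l + f (u 0%N) - f (u n) by ring.
have /cvg_ex[p /cvgrPdist_lt hp] := key _ (raddfB _) (@ler_Re_cmod R).
have /cvg_ex[q /cvgrPdist_lt hq] := key _ (raddfB _) (@ler_Im_cmod R).
apply/cvg_ex; exists (p +i* q); apply/cvg_cmodP => e e0.
have e20 : 0 < e / 2 by rewrite divr_gt0.
near=> n.
apply: le_lt_trans (ler_cmod_ReIm _) _; rewrite (splitr e) !raddfB /=.
by apply: ltrD; near: n; [exact: hp | exact: hq].
Unshelve. all: by end_near.
Qed.

Lemma cvg_cmod (R : realType) (T : Type) (F : set_system T) {FF : Filter F}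
    (u : T -> R[i]) (l : R[i]) :
  (u : T -> R[i]^o) @ F --> (l : R[i]^o) -> cmod (u x) @[x --> F] --> cmod l.
Proof.
move=> /cvg_cmodP H; apply/cvgrPdist_lt => e /H; apply: filterS => x.
apply: le_lt_trans; rewrite ler_norml; apply/andP; split.
  rewrite lerNl opprB lerBlDr.
  have {1}-> : u x = (u x - l) + l by ring.
  by rewrite (le_trans (ler_cmodD _ _))// cmodB.
rewrite lerBlDr.
have {1}-> : l = (l - u x) + u x by ring.
by rewrite ler_cmodD.
Qed.

Lemma ler_cmod_prod (R : realType) (I : Type) (s : seq I) (P : pred I)
    (f : I -> R[i]) (c : I -> R) :
  (forall i, P i -> cmod (f i) <= c i) ->
  cmod (\prod_(i <- s | P i) f i) <= \prod_(i <- s | P i) c i.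
Proof.
move=> fc; elim/big_ind2 : _ => //; first by rewrite cmod1.
by move=> x a y b hx hy; rewrite cmodM ler_pM ?cmod_ge0.
Qed.

(** The factors are exchanged one at a time. As [1 <= c i], the full product of the [c i] also
    bounds the product without the exchanged factor. *)
Lemma ler_cmod_prodB (R : realType) (I : Type) (s : seq I) (P : pred I)
    (f g : I -> R[i]) (c : I -> R) :
  (forall i, P i -> cmod (f i) <= c i) -> (forall i, P i -> cmod (g i) <= c i) ->
  (forall i, P i -> 1 <= c i) ->
  cmod (\prod_(i <- s | P i) f i - \prod_(i <- s | P i) g i) <=
  (\sum_(i <- s | P i) cmod (f i - g i)) * \prod_(i <- s | P i) c i.
Proof.
move=> fc gc c1.
elim: s => [|i s IH].
  by rewrite !big_nil subrr cmod0 mul0r.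
rewrite !big_cons; case: ifPn => // Pi.
set F := \prod_(j <- s | P j) f j; set G := \prod_(j <- s | P j) g j.
set C := \prod_(j <- s | P j) c j.
have -> : f i * F - g i * G = (f i - g i) * F + g i * (F - G) by ring.
apply: le_trans (ler_cmodD _ _) _; rewrite !cmodM mulrDl; apply: lerD.
  rewrite ler_wpM2l ?cmod_ge0// (le_trans (ler_cmod_prod _ fc))//.
  by rewrite ler_peMl ?c1//; apply: le_trans (cmod_ge0 F) (ler_cmod_prod _ fc).
by rewrite mulrCA ler_pM ?cmod_ge0 ?gc.
Qed.

Lemma series_le_limn (R : realType) (v : nat -> R) n :
  (forall j, 0 <= v j) -> cvgn (series v) -> series v n <= limn (series v).
Proof.
move=> v0 cv; apply: nondecreasing_cvgn_le => //.
by apply/nondecreasing_seqP => m; rewrite /series /= big_nat_recr//= lerDl.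
Qed.

(** * The canonical product, with a factor deleted, and the derivative at a zero *)

Section CanonicalProduct.
Variables (R : realType) (lam : nat -> R[i]).
Hypothesis lam0 : forall j, lam j != 0.
Hypothesis lam2 : cvgn (series (fun j => cmod (lam j) ^- 2)).
Implicit Types (Q : pred nat) (z w : R[i]) (n : nat).

Let S := limn (series (fun j => cmod (lam j) ^- 2)).

Let v_ge0 j : 0 <= cmod (lam j) ^- 2.
Proof. by rewrite invr_ge0 exprn_ge0// cmod_ge0. Qed.

Let sum_leS Q n : \sum_(0 <= j < n | Q j) cmod (lam j) ^- 2 <= S.
Proof.
apply: le_trans (series_le_limn n v_ge0 lam2); rewrite /series /= big_mkcond.
by apply: ler_sum => j _; case: ifP.
Qed.

(** Taking [Q := predC1 k] deletes the [k]-th factor without reindexing. *)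
Definition partial_product Q z n : R[i] :=
  \prod_(0 <= j < n | Q j) (1 - z ^+ 2 / lam j ^+ 2).

Let cmod_factor z m j : cmod z ^+ 2 <= m ->
  cmod (1 - z ^+ 2 / lam j ^+ 2) <= 1 + m * cmod (lam j) ^- 2.
Proof.
move=> zm; apply: le_trans (ler_cmodD _ _) _.
rewrite cmod1 lerD2l cmodN cmodM cmodV !cmodX.
by rewrite ler_wpM2r.
Qed.

Let prod_le_exp Q m n : 0 <= m ->
  \prod_(0 <= j < n | Q j) (1 + m * cmod (lam j) ^- 2) <= expR (m * S).
Proof.
move=> m0; apply: (@le_trans _ _ (expR (m * \sum_(0 <= j < n | Q j) cmod (lam j) ^- 2))).
  rewrite mulr_sumr expR_sum; apply: ler_prod => j _.
  by rewrite expR_ge1Dx addr_ge0// mulr_ge0.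
by rewrite ler_expR ler_wpM2l// sum_leS.
Qed.

(** Successive partial products differ by at most a bounded product times [m * cmod (lam n) ^- 2],
    which is summable. *)
Lemma is_cvg_partial_product Q z : cvgn (partial_product Q z : nat -> R[i]^o).
Proof.
pose m := cmod z ^+ 2; have m0 : 0 <= m by rewrite sqr_ge0.
apply: (@is_cvg_complex_dom _ _
    (fun n => expR (m * S) * m * cmod (lam n) ^- 2)); last first.
  exact: (@is_cvg_seriesZ _ _ (expR (m * S) * m) lam2).
move=> n; rewrite /partial_product big_mkcond big_nat_recr//= -big_mkcond /=.
set u := \prod_(_ <- _ | _) _; case: ifP => _; last first.
  by rewrite mulr1 subrr cmod0 !mulr_ge0 ?expR_ge0 ?cmod_ge0.
have -> : u * (1 - z ^+ 2 / lam n ^+ 2) - u = - (u * (z ^+ 2 / lam n ^+ 2)) by ring.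
rewrite cmodN !cmodM cmodV !cmodX -[leRHS]mulrA; apply: ler_wpM2r.
  by rewrite mulr_ge0 ?sqr_ge0.
apply: le_trans (prod_le_exp Q n m0); apply: ler_cmod_prod => j _.
exact: cmod_factor.
Qed.

Definition canonical_product Q z : R[i]^o := limn (partial_product Q z : nat -> R[i]^o).

(** The comparison of finite products is uniform in [n] on a disc, hence survives the limit. It
    supplies the continuity needed to differentiate at a zero. *)
Lemma canonical_product_lipschitz Q z w m : cmod z ^+ 2 <= m -> cmod w ^+ 2 <= m ->
  cmod (canonical_product Q z - canonical_product Q w) <=
  cmod (z ^+ 2 - w ^+ 2) * S * expR (m * S).
Proof.
move=> zm wm; have m0 : 0 <= m := le_trans (sqr_ge0 _) zm.
have cvgB : (fun n => partial_product Q z n - partial_product Q w n : R[i]^o) @ \oo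
    --> (canonical_product Q z - canonical_product Q w : R[i]^o).
  by apply: cvgB; exact: is_cvg_partial_product.
apply: cvgr_to_le (cvg_cmod cvgB) _.
apply: nearW => n.
apply: (@le_trans _ _ ((\sum_(0 <= j < n | Q j)
    cmod ((1 - z ^+ 2 / lam j ^+ 2) - (1 - w ^+ 2 / lam j ^+ 2))) *
    \prod_(0 <= j < n | Q j) (1 + m * cmod (lam j) ^- 2))).
  apply: ler_cmod_prodB => j _; [exact: cmod_factor | exact: cmod_factor |].
  by rewrite lerDl mulr_ge0.
rewrite ler_pM ?prod_le_exp ?sumr_ge0//.
- by move=> j _; rewrite cmod_ge0.
- by rewrite prodr_ge0// => j _; rewrite addr_ge0// mulr_ge0.
apply: (@le_trans _ _ (\sum_(0 <= j < n | Q j)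
    cmod (z ^+ 2 - w ^+ 2) * cmod (lam j) ^- 2)); last first.
  by rewrite -mulr_sumr ler_wpM2l// ?cmod_ge0.
apply: ler_sum => j _; rewrite -cmodX -cmodV -cmodM -cmodN.
by have -> : - (1 - z ^+ 2 / lam j ^+ 2 - (1 - w ^+ 2 / lam j ^+ 2))
  = (z ^+ 2 - w ^+ 2) / lam j ^+ 2 by ring.
Qed.

Lemma condensation_productD1 k z : condensation_product lam z =
  (1 - z ^+ 2 / lam k ^+ 2) * canonical_product (predC1 k) z.
Proof.
apply: cvg_lim; first exact: norm_hausdorff.
apply: (@cvg_trans _ (((1 - z ^+ 2 / lam k ^+ 2) *: partial_product (predC1 k) z n : R[i]^o)
   @[n --> \oo])); last first.
  by apply: cvgZl_tmp; exact: is_cvg_partial_product.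
apply: near_eq_cvg; near=> n.
rewrite /partial_product [RHS](bigD1_seq k)//= ?iota_uniq//.
rewrite mem_index_iota /=; near: n; exact: nbhs_infty_gt.
Unshelve. all: by end_near.
Qed.

(** The [k]-th factor vanishes at [a = lam k], so the difference quotient is an explicit multiple of
    [F (h + a)], and continuity of [F] at [a] suffices. *)
Lemma derive1_condensation_product k :
  derive1 (condensation_product lam) (lam k) =
  - (2 / lam k) * canonical_product (predC1 k) (lam k).
Proof.
set a := lam k; pose F := canonical_product (predC1 k).
have a0 : a != 0 by exact: lam0.
(* [m] bounds the squared modulus on the unit disc around [a]; [C] adds up the bounds, for
   [cmod h <= 1], on the two error terms of the difference quotient, each divided by [cmod h]. *)
pose m := (cmod a + 1) ^+ 2.
pose C := cmod (2 / a) * ((2 * cmod a + 1) * S * expR (m * S)) +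
  cmod (a ^- 2) * (cmod (F a) + ((2 * cmod a + 1) * S * expR (m * S))).
have S0 : 0 <= S by have := sum_leS predT 0; rewrite big_geq.
have Flip h : cmod h <= 1 -> cmod (F (h + a) - F a) <=
    cmod h * ((2 * cmod a + 1) * S * expR (m * S)).
  move=> h1; apply: le_trans (@canonical_product_lipschitz _ _ _ m _ _) _.
  - rewrite /m ler_sqr ?nnegrE ?addr_ge0 ?cmod_ge0//.
    by rewrite addrC (le_trans (ler_cmodD _ _))// lerD2l.
  - by rewrite /m ler_sqr ?nnegrE ?addr_ge0 ?cmod_ge0// lerDl.
  have -> : (h + a) ^+ 2 - a ^+ 2 = h * (2 * a + h) by ring.
  rewrite cmodM -!mulrA ler_wpM2l ?cmod_ge0// ler_wpM2r ?mulr_ge0 ?expR_ge0//.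
  rewrite (le_trans (ler_cmodD _ _))// lerD// cmodM.
  by rewrite -(rmorph_nat (real_complex R)) cmod_realC ger0_norm.
have C0 : 0 <= C.
  by rewrite !(cmod_ge0, expR_ge0, ler01, ler0n, addr_ge0, mulr_ge0).
have C1 : 0 < C + 1 by rewrite ltr_wpDl.
apply: cvg_lim; first exact: norm_hausdorff.
apply/cvg_cmodP => e e0.
have near_lt (d : R) : 0 < d -> \forall h \near (0 : R[i]^o)^', cmod h < d.
  move=> d0; apply: nbhs_dnbhs; near=> h.
  rewrite -ltcR -cmod_norm; near: h.
  by apply: (@nbhs0_lt _ (R[i]^o)); rewrite ltcR.
near=> h.
have hn0 : h != 0 by near: h; exact: nbhs_dnbhs_neq.
have h1 : cmod h <= 1 by apply: ltW; near: h; exact: near_lt.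
have -> : h^-1 *: (condensation_product lam (h + a) - condensation_product lam a) =
    - ((2 * a + h) / a ^+ 2 * F (h + a)).
  rewrite !(condensation_productD1 k) -/a -/F divff ?expf_neq0// subrr mul0r subr0.
  by rewrite /GRing.scale /=; field; rewrite a0.
have -> : - (2 / a) * F a - - ((2 * a + h) / a ^+ 2 * F (h + a)) =
   2 / a * (F (h + a) - F a) + h * (a ^- 2 * (F a + (F (h + a) - F a))).
  by field.
apply: (@le_lt_trans _ _ (cmod h * C)).
  apply: le_trans (ler_cmodD _ _) _; rewrite /C [leRHS]mulrDr; apply: lerD.
    by rewrite cmodM mulrCA ler_wpM2l ?cmod_ge0// Flip.
  rewrite !cmodM ler_wpM2l ?cmod_ge0// ler_wpM2l ?cmod_ge0//.
  rewrite (le_trans (ler_cmodD _ _))// lerD2l (le_trans (Flip _ h1))//.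
  by rewrite ler_piMl// !(cmod_ge0, expR_ge0, ler01, ler0n, addr_ge0, mulr_ge0).
apply: (@le_lt_trans _ _ (cmod h * (C + 1))); first by rewrite ler_wpM2l ?cmod_ge0// lerDl.
by rewrite -ltr_pdivlMr//; near: h; apply: near_lt; rewrite divr_gt0.
Unshelve. all: by end_near.
Qed.

End CanonicalProduct.

(** * Real inequalities: powers, logarithms and single factors *)

(** This is [ln t <= t - 1] at [t = x ^ s]. *)
Lemma ln_le_powR (R : realType) (s x : R) : 0 < s -> 0 < x -> ln x <= x `^ s / s.
Proof.
move=> s0 x0; rewrite ler_pdivlMr// mulrC -ln_powR.
have xs0 : 0 < x `^ s by rewrite powR_gt0.
have /le_ln1Dx : -1 < x `^ s - 1 by rewrite ltrBrDl subrr.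
by rewrite addrC subrK => /le_trans; apply; rewrite gerBl.
Qed.

Lemma powR_littleo (R : realType) (theta C eps : R) : theta < 1 -> 0 < eps ->
  exists X, forall x, X <= x -> C * x `^ theta <= eps * x.
Proof.
move=> t1 e0; have t0 : 0 < 1 - theta by rewrite subr_gt0.
have [C0|C0] := leP C 0.
  exists 0 => x x0; apply: (@le_trans _ _ 0).
    by rewrite mulr_le0_ge0// powR_ge0.
  by rewrite mulr_ge0// ltW.
(* For [x > 0] the claim amounts to [C / eps <= x ^ (1 - theta)]; the maximum with 1 keeps [x]
   positive. *)
exists (Order.max 1 ((C / eps) `^ (1 - theta)^-1)) => x; rewrite ge_max => /andP[x1 xC].
have x0 : 0 < x by rewrite (lt_le_trans ltr01).
have xE : x = x `^ theta * x `^ (1 - theta).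
  by rewrite -powRD ?(gt_eqF x0) ?implybT// addrC subrK powRr1// ltW.
rewrite [X in eps * X]xE mulrCA mulrC ler_wpM2l ?powR_ge0// [leRHS]mulrC -ler_pdivrMr//.
have -> : C / eps = (C / eps) `^ (1 - theta)^-1 `^ (1 - theta).
  by rewrite -powRrM mulVf ?gt_eqF// powRr1// divr_ge0 ?ltW.
by apply: ge0_ler_powR; rewrite ?nnegrE ?powR_ge0 ?(ltW t0) ?(ltW x0).
Qed.

(** Factor out [y ^ a]: then [(1 + 2 / y) ^ a <= 1 + 2 / y] and [y ^ a <= y], both because
    [a <= 1]. *)
Lemma powRD2_le (R : realType) (a y : R) : 0 <= a <= 1 -> 1 <= y ->
  (y + 2) `^ a <= y `^ a + 2.
Proof.
move=> /andP[a0 a1] y1; have y0 : 0 < y by rewrite (lt_le_trans ltr01).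
have -> : y + 2 = y * (1 + 2 / y) by field; rewrite gt_eqF.
have q1 : 1 <= 1 + 2 / y by rewrite lerDl divr_ge0// ltW.
rewrite powRM ?(ltW y0) ?(le_trans ler01 q1)//.
apply: (@le_trans _ _ (y `^ a * (1 + 2 / y))).
  by rewrite ler_wpM2l ?powR_ge0// ler1_powR.
by rewrite mulrDr mulr1 lerD2l mulrCA ger_pMr// ler_pdivrMr// mul1r ler1_powR.
Qed.

Lemma sum_interval_le (R : realType) (c : R) (m1 m2 n : nat) : 0 <= c ->
  \sum_(0 <= j < n | (m1 <= j < m2)%N) c <= c *+ (m2 - m1).
Proof.
move=> c0; rewrite big_const_seq iter_addr_0; apply: ler_wpMn2l => //.
rewrite -size_filter -(size_iota m1 (m2 - m1)); apply: uniq_leq_size.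
  by rewrite filter_uniq// iota_uniq.
by move=> j; rewrite mem_filter mem_iota => /andP[h _]; lia.
Qed.

(** With [t = x / y < 1 / 2], the lower bound follows from [(1 - t ^ 2) * (1 + t) >= 1] and
    [1 + t <= expR t]. *)
Lemma factor_far (R : realType) (x y : R) : 0 < x -> 2 * x < y ->
  expR (- (x / y)) <= `|1 - x ^+ 2 / y ^+ 2| <= expR (x / y).
Proof.
move=> x0 xy; have y0 : 0 < y by lra.
rewrite -expr_div_n; set t := x / y.
have t0 : 0 < t by rewrite divr_gt0.
have t2 : t < 1 / 2 by rewrite ltr_pdivrMr//; lra.
have t1 : 0 <= 1 - t ^+ 2 by nra.
rewrite (ger0_norm t1); have e1 := expR_ge1Dx t.
apply/andP; split; last by have := sqr_ge0 t; lra.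
rewrite expRN -div1r ler_pdivrMr ?expR_gt0//.
by apply: le_trans (ler_wpM2l t1 e1); nra.
Qed.

(** The factor equals [(y - x) * (y + x) / y ^ 2]. Below, [y <= 2 * x] gives
    [(y + x) / y ^ 2 >= 1 / (2 * x)]; above, [x ^ 2] and [y ^ 2] are both at most
    [x ^ 2 * y ^ 2]. *)
Lemma factor_near (R : realType) (x y d : R) : 1 <= x -> 1 <= y -> y <= 2 * x ->
  0 <= d -> d <= `|y - x| ->
  d / (2 * x) <= `|1 - x ^+ 2 / y ^+ 2| <= (2 * x) ^+ 2.
Proof.
move=> x1 y1 yx d0 dxy; have y0 : 0 < y by lra.
have -> : 1 - x ^+ 2 / y ^+ 2 = (y - x) * ((y + x) / y ^+ 2) by field; rewrite gt_eqF.
have q0 : 0 <= (y + x) / y ^+ 2 by rewrite divr_ge0 ?sqr_ge0//; lra.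
have y2 : 0 < y ^+ 2 by rewrite exprn_gt0.
rewrite normrM (ger0_norm q0); apply/andP; split.
  rewrite ler_pM//; first by rewrite invr_ge0; lra.
  rewrite ler_pdivlMr// mulrC ler_pdivrMr; last by lra.
  nra.
rewrite mulrA ler_pdivrMr//.
have hx : 0 <= x ^+ 2 * (y ^+ 2 - 1) by rewrite mulr_ge0 ?sqr_ge0//; nra.
have hy : 0 <= y ^+ 2 * (x ^+ 2 - 1) by rewrite mulr_ge0 ?sqr_ge0//; nra.
by have [h|h] := leP y x; [rewrite ler0_norm | rewrite ger0_norm]; nra.
Qed.

(** * Counting function of an increasing sequence *)

(** A finite bound excludes that every term is at most [G]; by monotonicity the counted indices form
    an initial segment, and [m] is both its size and the first index beyond [G]. *)
Lemma counting_function_increasing (R : realType) (mu : nat -> R) (G x : R) :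
  (forall m n : nat, (m < n)%N -> mu m < mu n) ->
  (counting_function mu G <= x%:E)%E ->
  exists2 m : nat, forall k, (mu k <= G) = (k < m)%N &
    counting_function mu G = m%:R%:E.
Proof.
move=> incr Gx.
have exm : exists k, G < mu k.
  apply: contrapT => /forallNP H; move: Gx; rewrite /counting_function /counting.
  have -> : [set k | mu k <= G] = setT.
    by apply/seteqP; split => // k _ /=; rewrite leNgt; apply/negP/H.
  by case: asboolP => [/infinite_nat//|_]; rewrite leye_eq.
pose m := ex_minn exm.
have mP k : (mu k <= G) = (k < m)%N.
  rewrite /m; case: ex_minnP => p Gp pmin; apply/idP/idP => [kG|kp].
    rewrite ltnNge; apply/negP; rewrite leq_eqVlt => /orP[/eqP pk|/incr pk].
      by move: Gp; rewrite pk ltNge kG.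
    by have := lt_le_trans (lt_trans Gp pk) kG; rewrite ltxx.
  by rewrite leNgt; apply/negP => /pmin; rewrite leqNgt kp.
exists m => //; rewrite /counting_function /counting.
have -> : [set k | mu k <= G] = `I_m.
  by apply/seteqP; split => k /=; rewrite mP.
by rewrite asboolT// (@card_fset_set _ _ m).
Qed.

(** The partial sums telescope and stay below 1. This series will dominate that of the
    [(mu k)^-1]. *)
Lemma is_cvg_series_inv_sqrt_diff (R : realType) :
  cvgn (series (fun k => (Num.sqrt k.+1%:R)^-1 - (Num.sqrt k.+2%:R)^-1 : R)).
Proof.
apply: nondecreasing_is_cvgn.
  apply/nondecreasing_seqP => n; rewrite /series /= big_nat_recr//= lerDl subr_ge0.
  rewrite lef_pV2 ?posrE ?sqrtr_gt0 ?ltr0n//.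
  by rewrite ler_wsqrtr// ler_nat.
exists 1 => _ [n _ <-].
pose f k : R := - (Num.sqrt k.+1%:R)^-1.
rewrite /series /= (eq_bigr (fun k => f k.+1 - f k)); last first.
  by move=> k _; rewrite /f opprK addrC.
rewrite telescope_sumr// /f opprK sqrtr1 invr1 gerDr oppr_le0.
by rewrite invr_ge0 sqrtr_ge0.
Qed.

(** * Consequences of the counting estimates *)

Section IncreasingSequence.
Variables (R : realType) (a b cW1 cW2 : R) (mu : nat -> R).
Hypothesis ha : 1 / 2 <= a < 5 / 8.
Hypothesis hb : 0 < b < 1 / 2.
Hypothesis hcW1 : 0 < cW1.
Hypothesis hcW2 : 0 < cW2.
Hypothesis mu_incr : forall m n : nat, (m < n)%N -> mu m < mu n.
Hypothesis mu0_ge1 : 1 <= mu 0%N.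
Hypothesis mu_count : forall G : R, mu 0%N <= G ->
    ((cW1 * G `^ a - cW2 * G `^ b)%:E <= counting_function mu G)%E /\
    (counting_function mu G <= (cW1 * G `^ a + cW2 * G `^ b)%:E)%E.

Let a_ge : 1 / 2 <= a. Proof. by case/andP: ha. Qed.
Let a_lt : a < 5 / 8. Proof. by case/andP: ha. Qed.
Let b_gt0 : 0 < b. Proof. by case/andP: hb. Qed.
Let b_lt : b < 1 / 2. Proof. by case/andP: hb. Qed.

Lemma mu_mono : {mono mu : j k / (j <= k)%N >-> j <= k}.
Proof. exact: le_mono mu_incr. Qed.

Lemma mu_ge1 k : 1 <= mu k.
Proof. by rewrite (le_trans mu0_ge1)// mu_mono. Qed.

Lemma mu_gt0 k : 0 < mu k.
Proof. exact: lt_le_trans ltr01 (mu_ge1 k). Qed.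

Lemma mu_countP G : mu 0%N <= G ->
  exists2 m : nat, forall k, (mu k <= G) = (k < m)%N &
    cW1 * G `^ a - cW2 * G `^ b <= m%:R <= cW1 * G `^ a + cW2 * G `^ b.
Proof.
move=> /mu_count[lo hi].
have [m mP mE] := counting_function_increasing mu_incr hi.
by exists m => //; move: lo hi; rewrite mE !lee_fin => -> ->.
Qed.

(** The [k + 1] indices up to [k] are all counted at [G = mu k], and [b < a] with [mu k >= 1]
    absorbs the error term. *)
Lemma index_le k : k.+1%:R <= (cW1 + cW2) * mu k `^ a.
Proof.
have [|m mP /andP[_ hm]] := @mu_countP (mu k); first by rewrite mu_mono.
have km : (k < m)%N by rewrite -mP.
apply: (@le_trans _ _ m%:R); first by rewrite ler_nat.
apply: le_trans hm _; rewrite [leRHS]mulrDl lerD2l ler_wpM2l ?(ltW hcW2)//.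
by apply: ler_powR; [exact: mu_ge1 | move: a_ge a_lt b_lt; lra].
Qed.

(* [a < 2 / 3] gives [mu k >= c * k ^ (3 / 2)], and [k ^ (- 3 / 2)] is dominated
   by a telescoping series. *)
Lemma is_cvg_series_mu_inv : cvgn (series (fun k => (mu k)^-1)).
Proof.
pose C := cW1 + cW2; pose D := Num.sqrt (8 * C ^+ 3).
have C0 : 0 < C by rewrite addr_gt0.
apply: (@series_le_cvg _ _ (fun k => 2 * D *
   ((Num.sqrt k.+1%:R)^-1 - (Num.sqrt k.+2%:R)^-1))); last first.
- exact: (@is_cvg_seriesZ _ _ (2 * D) (@is_cvg_series_inv_sqrt_diff R)).
- move=> k.
  set x := mu k; have x0 : 0 < x := mu_gt0 k.
  set p := Num.sqrt k.+1%:R; set q := Num.sqrt k.+2%:R.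
  have p0 : 0 < p by rewrite sqrtr_gt0 ltr0n.
  have q0 : 0 < q by rewrite sqrtr_gt0 ltr0n.
  have p2 : p ^+ 2 = k.+1%:R by rewrite sqr_sqrtr// ler0n.
  have q2 : q ^+ 2 = k.+2%:R by rewrite sqr_sqrtr// ler0n.
  have pq : p <= q by rewrite ler_wsqrtr// ler_nat.
  (* Here [q ^ 2 = k + 2 <= 2 * (k + 1) <= 2 * C * x ^ (2 / 3)]; cubing gives
     [q ^ 6 <= 8 * C ^ 3 * x ^ 2], whence the choice of [D]. *)
  have q3 : q ^+ 3 <= D * x.
    rewrite -(ger0_norm (ltW x0)) -sqrtr_sqr -sqrtrM; last first.
      by rewrite mulr_ge0// exprn_ge0// ltW.
    rewrite -[leLHS]ger0_norm ?exprn_ge0 ?(ltW q0)// -sqrtr_sqr ler_wsqrtr//.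
    have -> : (q ^+ 3) ^+ 2 = (q ^+ 2) ^+ 3 by ring.
    have h1 : q ^+ 2 <= 2 * C * x `^ (2 / 3).
      apply: (@le_trans _ _ (2 * k.+1%:R)).
        by rewrite q2 -natrM ler_nat mul2n doubleS !ltnS -addnn leq_addr.
      rewrite -mulrA ler_wpM2l// (le_trans (index_le k))// ler_wpM2l ?(ltW C0)//.
      by apply: ler_powR; [exact: mu_ge1 | move: a_ge a_lt b_lt; lra].
    have -> : 8 * C ^+ 3 * x ^+ 2 = (2 * C * x `^ (2 / 3)) ^+ 3.
      rewrite !exprMn -(powR_mulrn 3 (powR_ge0 _ _)) -powRrM.
      have -> : (2 / 3 : R) * 3 = 2 by field.
      by rewrite (powR_mulrn 2 (ltW x0)); ring.
    by rewrite lerXn2r ?nnegrE ?sqr_ge0// (le_trans (sqr_ge0 q) h1).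
  have D0 : 0 < D by rewrite sqrtr_gt0 mulr_gt0// exprn_gt0.
  have -> : p^-1 - q^-1 = (q ^+ 2 - p ^+ 2) / (p * q * (p + q)).
    by field; rewrite !gt_eqF ?addr_gt0.
  have -> : q ^+ 2 - p ^+ 2 = 1 by rewrite q2 p2 -natrB// subSnn.
  rewrite mul1r -invf_div lef_pV2 ?posrE ?divr_gt0 ?mulr_gt0 ?addr_gt0//.
  rewrite ler_pdivrMr ?mulr_gt0//.
  (* The difference of inverse roots is [1 / (p * q * (p + q))], and [p <= q] bounds that
     denominator by [2 * q ^ 3]. *)
  by suff : p * q * (p + q) <= 2 * q ^+ 3; [lra | nra].
- move=> k; rewrite mulr_ge0 ?mulr_ge0 ?sqrtr_ge0// subr_ge0.
  rewrite lef_pV2 ?posrE ?sqrtr_gt0 ?ltr0n//.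
  by rewrite ler_wsqrtr// ler_nat.
- by move=> k; rewrite invr_ge0 ltW// mu_gt0.
Qed.

Lemma mu_inv_tail (eps : R) : 0 < eps -> exists N, forall n,
  \sum_(0 <= j < n | (N <= j)%N) (mu j)^-1 <= eps.
Proof.
move=> e0; have v0 j : 0 <= (mu j)^-1 by rewrite invr_ge0 ltW// mu_gt0.
have /cvgrPdist_lt/(_ _ e0)[N _ /(_ N (leqnn N)) /= hN] := is_cvg_series_mu_inv.
exists N => n; have [nN|Nn] := leqP n N.
  rewrite big_nat_cond big_pred0 ?ltW// => j.
  by apply/negP => /andP[/andP[_ jn]]; rewrite leqNgt (leq_trans jn nN).
rewrite -(big_nat_widenl N 0 n predT)//=.
have -> : \sum_(N <= j < n) (mu j)^-1 =
    series (fun k => (mu k)^-1) n - series (fun k => (mu k)^-1) N.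
  rewrite /series /= [X in _ = X - _](big_cat_nat (n := N))/=//; last exact: ltnW.
  by rewrite addrAC subrr add0r.
apply: le_trans (ltW (le_lt_trans (ler_norm _) hN)); rewrite lerD2r.
exact: (series_le_limn n v0 is_cvg_series_mu_inv).
Qed.

Lemma mu_unbounded X : \forall k \near \oo, X <= mu k.
Proof.
have [|m mP _] := @mu_countP (Order.max X (mu 0%N)); first by rewrite le_max lexx orbT.
exists m => // k /=; rewrite leqNgt -mP -ltNge gt_max => /andP[Xk _].
exact: ltW.
Qed.

Lemma sum_low_le (eps : R) : 0 < eps -> \forall k \near \oo, forall n,
  \sum_(0 <= j < n | mu j <= 2 * mu k) 2 * ln (2 * mu k) <= eps * mu k.
Proof.
move=> e0; have e2 : 0 < eps / 2 by rewrite divr_gt0.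
(* Half of the room below 1: the logarithm is traded for a power [s] with [a + s < 1]. *)
pose s := (1 - a) / 2.
have s0 : 0 < s by rewrite divr_gt0//; move: a_lt; lra.
have t1 : a + s < 1 by move: a_lt; rewrite /s; lra.
have [X hX] := powR_littleo ((cW1 + cW2) * (2 / s)) t1 e2.
apply: filterS (mu_unbounded X) => k; have := mu_ge1 k; have := mu_mono 0 k.
rewrite leq0n; set x := mu k => mu0x x1 xX n.
have x2 : 1 <= 2 * x by lra.
have x20 : 0 < 2 * x by lra.
have [|m mP /andP[_ hm]] := @mu_countP (2 * x); first by lra.
have c0 : 0 <= 2 * ln (2 * x) by rewrite mulr_ge0// ln_ge0.
rewrite (eq_bigl (fun j => (0 <= j < m)%N)); last by move=> j; rewrite mP.
apply: le_trans (sum_interval_le _ _ _ c0) _; rewrite subn0 -[leLHS]mulr_natl.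
apply: (@le_trans _ _ ((cW1 + cW2) * (2 * x) `^ a * (2 * ((2 * x) `^ s / s)))).
  apply: ler_pM; rewrite ?ler0n//.
    apply: le_trans hm _; rewrite [leRHS]mulrDl lerD2l ler_wpM2l ?(ltW hcW2)//.
    by apply: ler_powR => //; move: a_ge b_lt; lra.
  by rewrite ler_wpM2l// ln_le_powR.
have -> : (cW1 + cW2) * (2 * x) `^ a * (2 * ((2 * x) `^ s / s)) =
    (cW1 + cW2) * (2 / s) * (2 * x) `^ (a + s).
  by rewrite powRD ?(gt_eqF x20) ?implybT//; ring.
apply: (@le_trans _ _ (eps / 2 * (2 * x))); last by lra.
by apply: hX; lra.
Qed.

(* The main terms of the two counting estimates differ by a bounded amount over
   an interval of length 2, so that only their error terms matter. *)
Lemma count_close_le k (m1 m2 : nat) : mu 0%N + 1 <= mu k ->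
  cW1 * (mu k - 1) `^ a - cW2 * (mu k - 1) `^ b <= m1%:R ->
  m2%:R <= cW1 * (mu k + 1) `^ a + cW2 * (mu k + 1) `^ b ->
  (m2 - m1)%:R <= (2 * cW1 + 2 * cW2) * (2 * mu k) `^ b.
Proof.
set x := mu k => mu0x hm1 hm2.
have x1 : 1 <= x - 1 by move: mu0_ge1; lra.
have b0 : 0 <= b by exact: ltW.
have xb1 : 1 <= (2 * x) `^ b.
  have x2 : 1 <= 2 * x by lra.
  by have := ler_powR x2 b0; rewrite powRr0.
have xb2 : (x - 1) `^ b <= (2 * x) `^ b by rewrite ge0_ler_powR ?nnegrE//; lra.
have xb3 : (x + 1) `^ b <= (2 * x) `^ b by rewrite ge0_ler_powR ?nnegrE//; lra.
have xa : (x + 1) `^ a <= (x - 1) `^ a + 2.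
  have -> : x + 1 = x - 1 + 2 by ring.
  by apply: powRD2_le => //; apply/andP; split; move: a_ge a_lt; lra.
have [m12|m21] := leqP m2 m1.
  by rewrite (eqP m12) mulr_ge0 ?powR_ge0// addr_ge0// mulr_ge0// ltW.
rewrite natrB 1?ltnW//.
have h1 := ler_wpM2l (ltW hcW1) xa.
have h2 := ler_wpM2l (ltW hcW2) xb2.
have h3 := ler_wpM2l (ltW hcW2) xb3.
have h4 := ler_wpM2l (ltW hcW1) xb1.
lra.
Qed.

Lemma sum_close_le (cw eps : R) : 0 < cw -> 0 < eps ->
  \forall k \near \oo, forall n,
  \sum_(0 <= j < n | mu k - 1 < mu j <= mu k + 1) cw * mu k `^ (1 / 2)
    <= eps * mu k.
Proof.
move=> hcw e0; have e2 : 0 < eps / 2 by rewrite divr_gt0.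
have t1 : b + 1 / 2 < 1 by move: b_lt; lra.
have [X hX] := powR_littleo ((2 * cW1 + 2 * cW2) * cw) t1 e2.
apply: filterS2 (mu_unbounded X) (mu_unbounded (mu 0%N + 1)) => k.
set x := mu k => xX mu0x n.
have x1 : 1 <= x := mu_ge1 k.
have x20 : 0 < 2 * x by lra.
have [|m1 m1P /andP[hm1 _]] := @mu_countP (x - 1); first by lra.
have [|m2 m2P /andP[_ hm2]] := @mu_countP (x + 1); first by lra.
(* The window is half-open because both counts use a weak inequality: it is exactly the difference
   of the two initial segments. *)
rewrite (eq_bigl (fun j => (m1 <= j < m2)%N)); last first.
  by move=> j; rewrite m2P ltNge m1P -leqNgt.
have c0 : 0 <= cw * x `^ (1 / 2) by rewrite mulr_ge0 ?powR_ge0 ?ltW.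
apply: le_trans (sum_interval_le _ _ _ c0) _; rewrite -[leLHS]mulr_natl.
apply: (@le_trans _ _
    ((2 * cW1 + 2 * cW2) * (2 * x) `^ b * (cw * (2 * x) `^ (1 / 2)))).
  apply: ler_pM; rewrite ?ler0n//; first exact: count_close_le.
  have xx : x <= 2 * x by lra.
  rewrite ler_wpM2l ?(ltW hcw)// ge0_ler_powR ?nnegrE ?divr_ge0 ?(ltW x20)//.
  exact: le_trans ler01 x1.
have -> : (2 * cW1 + 2 * cW2) * (2 * x) `^ b * (cw * (2 * x) `^ (1 / 2)) =
    (2 * cW1 + 2 * cW2) * cw * (2 * x) `^ (b + 1 / 2).
  by rewrite powRD ?(gt_eqF x20) ?implybT//; ring.
apply: (@le_trans _ _ (eps / 2 * (2 * x))); last by lra.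
by apply: hX; lra.
Qed.

Lemma sum_far_le (eps : R) : 0 < eps -> \forall k \near \oo, forall n,
  \sum_(0 <= j < n | 2 * mu k < mu j) mu k / mu j <= eps * mu k.
Proof.
move=> /mu_inv_tail[N hN]; apply: filterS (mu_unbounded (mu N)) => k.
(* Once [mu k] has passed [mu N], every far index lies in the tail beyond [N]. *)
have xN j : mu N <= mu k -> 2 * mu k < mu j -> (N <= j)%N.
  by move=> Nk kj; rewrite -mu_mono; have := mu_gt0 k; lra.
have x0 := mu_gt0 k; move=> /xN{}xN n.
apply: (@le_trans _ _ (mu k * \sum_(0 <= j < n | (N <= j)%N) (mu j)^-1)).
  rewrite mulr_sumr [leLHS]big_mkcond [leRHS]big_mkcond; apply: ler_sum => j _.
  case: ifPn => [/xN->//|_].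
  by case: ifP => // _; rewrite divr_ge0// ltW// mu_gt0.
by rewrite mulrC ler_wpM2r// ltW.
Qed.

(** * The gap condition and the bound on the product without its vanishing factor *)

Variable cw : R.
Hypothesis hcw : 0 < cw.
Hypothesis mu_gap : forall k : nat,
    expR (- cw * mu k `^ (1 / 2)) <= mu k.+1 - mu k.

(** Above [k] the gap at [k] suffices. Below, the gap at [j] is used, and [mu j <= mu k] makes its
    bound at least the one at [k]. *)
Lemma mu_dist j k : j != k -> expR (- (cw * mu k `^ (1 / 2))) <= `|mu j - mu k|.
Proof.
have mup i : 0 <= mu i by rewrite ltW// mu_gt0.
rewrite neq_ltn => /orP[jk|kj].
  rewrite distrC; apply: le_trans (ler_norm _).
  apply: (@le_trans _ _ (mu j.+1 - mu j)); last by rewrite lerD2r mu_mono.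
  apply: le_trans (mu_gap j); rewrite ler_expR mulNr lerN2 ler_wpM2l ?(ltW hcw)//.
  by rewrite ge0_ler_powR ?nnegrE// mu_mono ltnW.
apply: le_trans (ler_norm _).
apply: (@le_trans _ _ (mu k.+1 - mu k)); last by rewrite lerD2r mu_mono.
by rewrite -mulNr.
Qed.

(** A bound for the absolute logarithm of the [j]-th factor, written as one summand per sum
    estimated above. The first two ranges overlap: a close point pays its gap cost on top of the
    logarithm. *)
Definition weight k j : R :=
  (if mu j <= 2 * mu k then 2 * ln (2 * mu k) else 0) +
  (if mu k - 1 < mu j <= mu k + 1 then cw * mu k `^ (1 / 2) else 0) +
  (if 2 * mu k < mu j then mu k / mu j else 0).

Lemma factor_weight k j : j != k ->
  expR (- weight k j) <= `|1 - mu k ^+ 2 / mu j ^+ 2| <= expR (weight k j).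
Proof.
move=> jk; rewrite /weight; have x1 := mu_ge1 k; have y1 := mu_ge1 j.
set x := mu k in x1 *; set y := mu j in y1 *.
have [yx|xy] := leP y (2 * x); last first.
  (* Since [x >= 1], a point beyond [2 * x] is also beyond [x + 1]. *)
  rewrite (_ : (_ < y <= _) = false) ?add0r; last by apply/negP => /andP[]; lra.
  by apply: factor_far => //; lra.
have x20 : 0 < 2 * x by lra.
have c0 : 0 <= cw * x `^ (1 / 2) by rewrite mulr_ge0 ?powR_ge0 ?ltW.
have l0 : 0 <= ln (2 * x) by rewrite ln_ge0//; lra.
have eln2 : expR (2 * ln (2 * x)) = (2 * x) ^+ 2.
  by rewrite expRM_natl lnK ?posrE.
have divE t : expR t / (2 * x) = expR (t - ln (2 * x)).
  by rewrite expRD (expRN (ln _)) lnK ?posrE.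
rewrite addr0; case: ifPn => near.
  have /andP[lo hi] := factor_near x1 y1 yx (expR_ge0 _) (mu_dist jk).
  apply/andP; split.
    apply: le_trans lo; rewrite divE ler_expR; lra.
  apply: le_trans hi _; rewrite -eln2 ler_expR; lra.
have d1 : 1 <= `|y - x|.
  move: near; rewrite negb_and -leNgt -ltNge => /orP[h|h].
    by rewrite distrC; apply: le_trans (ler_norm _); lra.
  by apply: le_trans (ler_norm _); lra.
have /andP[lo hi] := factor_near x1 y1 yx ler01 d1.
rewrite addr0 eln2 hi andbT; apply: le_trans lo.
have -> : 1 / (2 * x) = expR (0 - ln (2 * x)) by rewrite -divE expR0.
rewrite ler_expR; lra.
Qed.

Lemma weight_sum_le (eps : R) : 0 < eps -> \forall k \near \oo, forall n,
  \sum_(0 <= j < n | j != k) weight k j <= eps * mu k.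
Proof.
move=> e0; have e3 : 0 < eps / 3 by rewrite divr_gt0.
apply: filterS3 (sum_low_le e3) (sum_close_le hcw e3) (sum_far_le e3).
move=> k Hlow Hclose Hfar n.
have w0 j : 0 <= weight k j.
  rewrite /weight !addr_ge0//; case: ifP => // _.
  - by rewrite mulr_ge0// ln_ge0//; have := mu_ge1 k; lra.
  - by rewrite mulr_ge0 ?powR_ge0// ltW.
  - by rewrite divr_ge0 ?(ltW (mu_gt0 _)).
(* Weights are nonnegative, so the index [k] may be put back before splitting the sum. *)
apply: (@le_trans _ _ (\sum_(0 <= j < n) weight k j)).
  by rewrite big_mkcond /= ler_sum// => j _; case: ifP.
rewrite /weight !big_split /= -!big_mkcond /=.
have -> : eps * mu k = eps / 3 * mu k + eps / 3 * mu k + eps / 3 * mu k by field.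
exact: lerD (lerD (Hlow n) (Hclose n)) (Hfar n).
Qed.

(** The weight bounds are multiplied over [j]; being uniform in [n], the result passes to the
    infinite product. *)
Lemma product_estimate (eps : R) : 0 < eps -> \forall k \near \oo, forall n,
  expR (- (eps * mu k)) <=
  \prod_(0 <= j < n | j != k) `|1 - mu k ^+ 2 / mu j ^+ 2| <= expR (eps * mu k).
Proof.
move=> /weight_sum_le; apply: filterS => k /[swap] n /(_ n) W; apply/andP; split.
  apply: (@le_trans _ _ (expR (\sum_(0 <= j < n | j != k) - weight k j))).
    by rewrite ler_expR sumrN lerN2.
  rewrite expR_sum; apply: ler_prod => j jk; rewrite expR_ge0 /=.
  by case/andP: (factor_weight jk).
apply: (@le_trans _ _ (expR (\sum_(0 <= j < n | j != k) weight k j))).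
  rewrite expR_sum; apply: ler_prod => j jk; rewrite normr_ge0 /=.
  by case/andP: (factor_weight jk).
by rewrite ler_expR.
Qed.

End IncreasingSequence.

Unset Implicit Arguments.

(** * Admissibility and vanishing of the condensation index *)

Theorem corollary1p6 (R : realType) (a b cW1 cW2 cw : R) (mu : nat -> R)
  (ha : 1 / 2 <= a < 5 / 8) (hb : 0 < b < 1 / 2)
  (hcW1 : 0 < cW1) (hcW2 : 0 < cW2) (hcw : 0 < cw)
  (mu_incr : forall m n : nat, (m < n)%N -> mu m < mu n)
  (mu0_ge1 : 1 <= mu 0%N)
  (mu_count : forall G : R, mu 0%N <= G ->
    ((cW1 * G `^ a - cW2 * G `^ b)%:E <= counting_function mu G)%E /\
    (counting_function mu G <= (cW1 * G `^ a + cW2 * G `^ b)%:E)%E)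
  (mu_gap : forall k : nat,
    expR (- cw * mu k `^ (1 / 2)) <= mu k.+1 - mu k) :
  condensation_admissible (fun k => (mu k)%:C) /\
  condensation_index (fun k => (mu k)%:C) = 0%E.
Proof.
have mu1 := mu_ge1 mu_incr mu0_ge1; have mu0 := mu_gt0 mu_incr mu0_ge1.
have cmod_mu k : cmod (mu k)%:C = mu k by rewrite cmod_realC gtr0_norm.
have lam0 k : (mu k)%:C != 0 by rewrite fmorph_eq0 gt_eqF.
have cvg_inv : cvgn (series (fun k => (mu k)^-1)).
  apply: is_cvg_series_mu_inv ha hb hcW1 hcW2 mu_incr mu0_ge1 mu_count.
split.
  split=> //.
  - by move=> j k /complexI /(inc_inj (mu_mono mu_incr)).
  - by under eq_fun do rewrite cmodV cmod_mu.
  - by exists 1 => // k; rewrite mul1r cmod_mu.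
have lam2 : cvgn (series (fun k => cmod (mu k)%:C ^- 2)).
  apply: series_le_cvg cvg_inv => k; rewrite ?cmod_mu ?invr_ge0 ?exprn_ge0 ?(ltW (mu0 k))//.
  by rewrite lef_pV2 ?posrE ?exprn_gt0// ler_eXnr.
(* The upper limit is obtained from an actual limit: the quotients converge to 0. *)
rewrite /condensation_index; apply: (cvg_limn_einf_sup _).2.
apply: cvg_EFin; first exact: nearW.
apply/cvgrPdist_le => e e0 /=.
have e2 : 0 < e / 2 by rewrite divr_gt0.
have e4 : 0 < e / 4 by rewrite divr_gt0.
have prodE := product_estimate ha hb hcW1 hcW2 mu_incr mu0_ge1 mu_count hcw mu_gap e2.
have h1 : 1 / 2 < 1 :> R by lra.
(* This will give [ln (2 * x) <= 2 * (2 * x) ^ (1 / 2) <= e / 4 * (2 * x) = e / 2 * x]; the other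
   half of [e] pays for the product. *)
have [X hX] := powR_littleo 2 h1 e4.
apply: filterS2 prodE (mu_unbounded mu_incr mu_count X) => k hk xX.
rewrite (derive1_condensation_product lam0 lam2).
set x := mu k in hk xX *; have x0 : 0 < x := mu0 k.
set g := canonical_product _ _ _.
rewrite sub0r normrN.
have gE : expR (- (e / 2 * x)) <= cmod g <= expR (e / 2 * x).
  have gc : cmod (partial_product (fun k => (mu k)%:C) (predC1 k) x%:C n) @[n --> \oo]
      --> cmod g.
    by apply: cvg_cmod; exact: is_cvg_partial_product.
  have pE n : cmod (partial_product (fun k => (mu k)%:C) (predC1 k) x%:C n) =
      \prod_(0 <= j < n | j != k) `|1 - x ^+ 2 / mu j ^+ 2|.
    rewrite /partial_product (big_morph _ (@cmodM R) (@cmod1 R)).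
    apply: eq_bigr => j _.
    by rewrite -cmod_realC rmorphB rmorph1 rmorphM fmorphV !rmorphXn.
  apply/andP; split.
    by apply: (cvgr_to_ge gc); apply: nearW => n; rewrite pE; case/andP: (hk n).
  by apply: (cvgr_to_le gc); apply: nearW => n; rewrite pE; case/andP: (hk n).
have g0 : 0 < cmod g by case/andP: gE => /(lt_le_trans (expR_gt0 _)).
have -> : cmod (- (2 / x%:C) * g) = cmod g / (x / 2).
  rewrite cmodM cmodN cmodM cmodV cmod_realC gtr0_norm//.
  by rewrite -(rmorph_nat (real_complex R)) cmod_realC ger0_norm//; field; rewrite gt_eqF.
(* Besides [ln (cmod g)], only the logarithm of the prefactor [2 / x] remains. *)
have -> : ln (1 / (cmod g / (x / 2))) = ln x - ln 2 - ln (cmod g).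
  by rewrite div1r invf_div !ln_div ?posrE ?divr_gt0.
have x1 : 1 <= x := mu1 k.
have lx0 : 0 <= ln x by rewrite ln_ge0.
have l20 : 0 <= ln 2 :> R by rewrite ln_ge0// ler1n.
have lnx : ln x + ln 2 <= e / 2 * x.
  rewrite -lnM ?posrE//.
  apply: (@le_trans _ _ (2 * (2 * x) `^ (1 / 2))).
    rewrite mulrC; apply: le_trans (ln_le_powR (s := 1 / 2) _ _) _; rewrite ?mulr_gt0//.
    lra.
  apply: (@le_trans _ _ (e / 4 * (2 * x))); last by lra.
  by apply: hX; lra.
case/andP: gE => glo ghi.
have : - (e / 2 * x) <= ln (cmod g) by rewrite -[leLHS]expRK ler_ln ?posrE ?expR_gt0.
have : ln (cmod g) <= e / 2 * x by rewrite -[leRHS]expRK ler_ln ?posrE ?expR_gt0.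
move=> gu gl; rewrite normf_div (gtr0_norm x0) ler_pdivrMr// ler_norml.
by apply/andP; split; lra.
Qed.
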